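(* $$\mathfrak{P}_{2d}=\lim_{n\rightarrow \infty} \mathcal{P}^S_{n,2d} \quad \text{and} \quad \mathfrak{S}_{2d}=\lim_{n\rightarrow \infty} \Sigma^S_{n,2d}.$$
   Context: For $n$ variables define the normalized power sums $p_i^{(n)}:=\frac{1}{n}(x_1^i+\ldots+x_n^i)$, and for a partition $\lambda=(\lambda_1,\ldots,\lambda_l)\vdash k$ with $n\geq k$ set $p_\lambda^{(n)}:=p_{\lambda_1}^{(n)}\cdots p_{\lambda_l}^{(n)}$. Let $H^S_{n,2d}$ be the real vector space of symmetric forms of degree $2d$ in $n$ variables; for $n\geq 2d$ the polynomials $\{p_\lambda^{(n)}:\lambda\vdash 2d\}$ form a basis of $H^S_{n,2d}$, whose dimension is $\pi(2d)$, the number of partitions of $2d$. Let $\mathcal{P}^S_{n,2d}$ be the cone of nonnegative forms in $H^S_{n,2d}$ and $\Sigma^S_{n,2d}$ the cone of forms in $H^S_{n,2d}$ that are sums of squares. Identifying a form $\sum_{\lambda\vdash 2d}c_\lambda p^{(n)}_\lambda$ with its coefficient vector $(c_\lambda)\in\mathbb{R}^{\pi(2d)}$, all these cones (for every $n\geq 2d$) are regarded as subsets of the same space $\mathbb{R}^{\pi(2d)}$, so limits of these sequences of sets as $n\to\infty$ make sense. Define $\mathfrak{P}_{2d}=\bigcap_{n=2d}^{\infty} \mathcal{P}_{n,2d}^S$ and $\mathfrak{S}_{2d}=\bigcap_{n=2d}^{\infty} \Sigma_{n,2d}^S$ (intersections taken in $\mathbb{R}^{\pi(2d)}$). *)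

(* Defs.v *)
From HB Require Import structures.
From mathcomp Require Import all_boot all_order all_algebra.
From mathcomp Require Import reals.
From mathcomp Require Import mpoly.
Set Implicit Arguments. Unset Strict Implicit. Unset Printing Implicit Defensive.
Import Order.TTheory GRing.Theory Num.Theory.
Local Open Scope ring_scope.

(* Partitions of k, in multiplicity form: m i = number of parts equal to i
   (for 1 <= i <= k); m 0 = 0 and sum_i i * m i = k.  This is in bijection
   with the usual partitions lambda |- k, so functions  part k -> R  are the
   coefficient vectors in R^{pi(k)}. *)
Definition is_partm (k : nat) (m : {ffun 'I_k.+1 -> 'I_k.+1}) : bool :=
  ((m ord0 : nat) == 0%N) && ((\sum_(i < k.+1) (i : nat) * (m i : nat))%N == k).

Definition part (k : nat) := {m : {ffun 'I_k.+1 -> 'I_k.+1} | is_partm m}.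

Definition npsum (R : realType) (n i : nat) : {mpoly R[n]} :=
  (n%:R)^-1 *: \sum_(j < n) 'X_j ^+ i.

Definition plam (R : realType) (n k : nat) (l : part k) : {mpoly R[n]} :=
  \prod_(i < k.+1) npsum R n i ^+ (val l i : nat).

Definition symform (R : realType) (n k : nat) (c : part k -> R) : {mpoly R[n]} :=
  \sum_(l : part k) c l *: @plam R n k l.

Definition PS (R : realType) (n d : nat) (c : part (2 * d) -> R) : Prop :=
  forall x : 'I_n -> R, 0 <= meval x (@symform R n (2 * d) c).

Definition SigmaS (R : realType) (n d : nat) (c : part (2 * d) -> R) : Prop :=
  exists s : seq {mpoly R[n]}, @symform R n (2 * d) c = \sum_(q <- s) q ^+ 2.

Definition frakP (R : realType) (d : nat) (c : part (2 * d) -> R) : Prop :=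
  forall n, (2 * d <= n)%N -> @PS R n d c.
Definition frakS (R : realType) (d : nat) (c : part (2 * d) -> R) : Prop :=
  forall n, (2 * d <= n)%N -> @SigmaS R n d c.

Definition set_limit (T : Type) (A : nat -> T -> Prop) (L : T -> Prop) : Prop :=
  (forall x, L x <-> exists N, forall n, (N <= n)%N -> A n x) /\
  (forall x, L x <-> forall N, exists n, (N <= n)%N /\ A n x).

(* Main.v *)
(* Given [n] and [m], substitute into a form in [n] variables each of [m] new
   variables repeated [n %/ m] times, and [0] for the remaining [n %% m]
   variables. This multiplies every power mean by the same factor
   [t = (n %/ m) * m / n], hence the coefficient of [p_lambda] by [t] to the
   number of parts of [lambda], and it preserves nonnegativity and sums of
   squares. As [n] tends to infinity, [t] tends to [1]; so if a coefficient
   vector is nonnegative (resp. a sum of squares) for infinitely many [n], the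
   form it defines in [m] variables is a limit of such forms of bounded degree.
   Both properties are closed, for sums of squares by a compactness argument on
   Gram matrices, so they hold for every [m], which gives both limits at once. *)

Require Import Defs.
From HB Require Import structures.
From mathcomp Require Import all_boot all_order all_algebra.
From mathcomp Require Import reals.
From mathcomp Require Import mpoly.
From mathcomp Require Import boolp classical_sets topology.
From mathcomp Require Import normedtype sequences.
From mathcomp Require Import lra ring zify.

Set Implicit Arguments. Unset Strict Implicit. Unset Printing Implicit Defensive.
Import Order.TTheory GRing.Theory Num.Theory.
Import numFieldNormedType.Exports.
Local Open Scope ring_scope.
Local Open Scope classical_set_scope.

(** * Limits of real sequences *)

Lemma cvg_sumr (R : realType) (I : Type) (r : seq I) (P : pred I)
    (a : nat -> I -> R) (l : I -> R) :
  (forall i, P i -> (fun n => a n i) @ \oo --> l i) ->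
  (fun n => \sum_(i <- r | P i) a n i) @ \oo --> \sum_(i <- r | P i) l i.
Proof.
move=> cvg_a; apply: (@cvg_big R I +%R 0 P _ nat \oo r (fun i n => a n i) l).
- exact: add_continuous.
- exact: cvg_a.
Qed.

Lemma cvg_subseq (R : realType) (a : nat -> R) (l : R) (phi : nat -> nat) :
  increasing_seq phi -> a @ \oo --> l -> (fun n => a (phi n)) @ \oo --> l.
Proof.
move=> phi_incr cvg_a; apply: (cvg_comp phi a) cvg_a.
move=> A [N _ NA]; exists N => // n /= le_Nn; apply: NA => /=.
apply: leq_trans le_Nn _; elim: n => // n IHn.
by apply: (leq_ltn_trans IHn); move/increasing_seqP: phi_incr; apply.
Qed.

(** Bolzano-Weierstrass is applied to one index after another along [enum I]; each refinement keeps
    the limits already obtained. *)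
Lemma bounded_family_subseq (R : realType) (I : finType) (M : R)
    (a : nat -> I -> R) :
  (forall n i, `|a n i| <= M) ->
  exists2 phi : nat -> nat, increasing_seq phi &
    exists l : I -> R, forall i, (fun n => a (phi n) i) @ \oo --> l i.
Proof.
move=> le_aM.
suff [phi phi_incr cvg_phi] : exists2 phi : nat -> nat, increasing_seq phi &
    forall i, i \in enum I -> exists l : R, (fun n => a (phi n) i) @ \oo --> l.
  have /choice [l cvg_l] i := cvg_phi i (mem_enum I i).
  by exists phi => //; exists l.
elim: (enum I) => [|i s [phi phi_incr cvg_phi]]; first by exists id.
have [] := @bolzano_weierstrass R (fun n => a (phi n) i).
  exists M; split; first exact: num_real.
  by move=> x ltMx n _ /=; apply: le_trans (le_aM _ _) (ltW ltMx).
move=> psi psi_incr /cvg_ex [l cvg_l].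
exists (phi \o psi) => [m n|j].
  exact: etrans (phi_incr _ _) (psi_incr _ _).
rewrite inE => /predU1P[->|/cvg_phi [l' cvg_l']]; first by exists l.
by exists l'; exact: (cvg_subseq psi_incr cvg_l').
Qed.

(** * Positive semidefinite matrices *)

Section PositiveSemidefinite.

Variables (R : rcfType) (I : finType).
Implicit Types (G : I -> I -> R) (v : I -> R).

Definition quad_form G v : R := \sum_i \sum_j v i * v j * G i j.

Definition psd G : Prop :=
  (forall i j, G i j = G j i) /\ (forall v, 0 <= quad_form G v).

Let sum_delta (k : I) (F : I -> R) : \sum_i (i == k)%:R * F i = F k.
Proof.
rewrite (bigD1 k) //= eqxx mul1r big1 ?addr0 // => i /negPf ->.
by rewrite mul0r.
Qed.

(** The next three lemmas come from choosing [v] and [t] in this expansion; basis vectors are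
    written [0 + 1 * _] there so that it applies. *)
Lemma quad_form_shift G v (k : I) (t : R) : (forall i j, G i j = G j i) ->
  quad_form G (fun i => v i + t * (i == k)%:R) =
  quad_form G v + 2 * t * (\sum_j v j * G k j) + t ^+ 2 * G k k.
Proof.
move=> symG.
have -> : quad_form G (fun i => v i + t * (i == k)%:R) =
    \sum_i (\sum_j v i * v j * G i j
            + t * (v i * \sum_j (j == k)%:R * G i j)
            + t * ((i == k)%:R * \sum_j v j * G i j)
            + t ^+ 2 * ((i == k)%:R * \sum_j (j == k)%:R * G i j)).
  apply: eq_bigr => i _; rewrite !mulr_sumr -!big_split /=.
  by apply: eq_bigr => j _; ring.
rewrite !big_split /= -!mulr_sumr !sum_delta.
under [X in t * X]eq_bigr => i _ do rewrite sum_delta symG.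
by rewrite /quad_form; ring.
Qed.

Lemma psd_diag_ge0 G (k : I) : psd G -> 0 <= G k k.
Proof.
case=> symG /(_ (fun i => 0 + 1 * (i == k)%:R)).
rewrite (quad_form_shift (fun=> 0)) // /quad_form.
rewrite big1 => [|i _]; last by rewrite big1 // => j _; rewrite !mul0r.
by rewrite big1 => [|i _]; rewrite ?mul0r //; lra.
Qed.

(** On the line through the basis vector [j] in direction [k], the form is affine in the parameter,
    with slope [2 * G k j]; a nonnegative affine function is constant. *)
Lemma psd_diag_eq0 G (k j : I) : psd G -> G k k = 0 -> G k j = 0.
Proof.
move=> psdG Gkk0; apply/eqP/negP => /negP Gkj_neq0.
have [symG psd_quad] := psdG.
pose e i : R := 0 + 1 * (i == j)%:R.
have quad_e : quad_form G e = G j j.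
  rewrite (quad_form_shift (fun=> 0)) // /quad_form.
  rewrite big1 => [|i _]; last by rewrite big1 // => l _; rewrite !mul0r.
  by rewrite big1 => [|i _]; rewrite ?mul0r //; ring.
(* At this parameter the affine function takes the value [-1]. *)
have := psd_quad (fun i => e i + - ((G j j + 1) / (2 * G k j)) * (i == k)%:R).
rewrite quad_form_shift // Gkk0 quad_e.
have -> : \sum_i e i * G k i = G k j.
  by rewrite -(sum_delta j (G k)); apply: eq_bigr => i _; rewrite /e; ring.
have -> : G j j + 2 * - ((G j j + 1) / (2 * G k j)) * G k j
    + (- ((G j j + 1) / (2 * G k j))) ^+ 2 * 0 = -1 by field.
by lra.
Qed.

(* Completing the square in the variable [k]; when [G k k = 0], the junk value
   [x / 0 = 0] makes the new matrix equal to [G]. *)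
Lemma psd_schur G (k : I) : psd G ->
  psd (fun i j => G i j - G k i * G k j / G k k).
Proof.
move=> psdG; have [symG psd_quad] := psdG.
split=> [i j|v]; first by rewrite symG [G k i * _]mulrC.
pose g := \sum_j v j * G k j.
suff -> : quad_form (fun i j => G i j - G k i * G k j / G k k) v =
    quad_form G (fun i => v i + - (g / G k k) * (i == k)%:R) by [].
rewrite quad_form_shift // -/g.
have -> : quad_form (fun i j => G i j - G k i * G k j / G k k) v =
    quad_form G v - g * g / G k k.
  rewrite /quad_form /g -mulrA mulr_suml -sumrB; apply: eq_bigr => i _.
  rewrite !(mulr_suml, mulr_sumr) -sumrB; apply: eq_bigr => j _.
  by ring.
have [->|Gkk_neq0] := eqVneq (G k k) 0; first by rewrite invr0; ring.
by field.
Qed.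

(** Cholesky decomposition: each Schur complement splits off one rank-one term and clears row [k].
    The induction runs over a list containing the indices of all nonzero rows. *)
Lemma psd_sum_rank1 G : psd G ->
  exists s : seq (I -> R), forall i j, G i j = \sum_(u <- s) u i * u j.
Proof.
have : forall i, i \notin enum I -> forall j, G i j = 0.
  by move=> i; rewrite mem_enum.
elim: (enum I) G => [|k r IHr] G supp_G psdG.
  by exists [::] => i j; rewrite big_nil supp_G.
have row_k j : G k j - G k k * G k j / G k k = 0.
  have [Gkk0|Gkk_neq0] := eqVneq (G k k) 0; last by field.
  by rewrite (psd_diag_eq0 j psdG Gkk0); ring.
have [i i_r j|s Gs] := IHr _ _ (psd_schur k psdG).
  have [->|neq_ik] := eqVneq i k; first exact: row_k.
  have row_i l : G i l = 0 by rewrite supp_G // inE negb_or neq_ik.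
  by rewrite (psdG.1 k i) !row_i; ring.
(* If [G k k = 0], this vector is [0], in agreement with the junk value in the Schur complement. *)
exists ((fun i => G k i / Num.sqrt (G k k)) :: s) => i j.
rewrite big_cons -Gs mulrACA -invfM -expr2 sqr_sqrtr ?psd_diag_ge0 //.
by ring.
Qed.

End PositiveSemidefinite.

Lemma psd_gram (R : rcfType) (I : finType) (J : Type) (s : seq J)
    (u : J -> I -> R) :
  psd (fun i j => \sum_(q <- s) u q i * u q j).
Proof.
split=> [i j|v]; first by apply: eq_bigr => q _; rewrite mulrC.
suff -> : quad_form (fun i j => \sum_(q <- s) u q i * u q j) v =
    \sum_(q <- s) (\sum_i v i * u q i) ^+ 2.
  by apply: sumr_ge0 => q _; exact: sqr_ge0.
under eq_bigr => q _.
  rewrite expr2 mulr_suml.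
  under eq_bigr => i _ do rewrite mulr_sumr.
  over.
rewrite exchange_big; apply: eq_bigr => i _.
rewrite exchange_big; apply: eq_bigr => j _.
by rewrite mulr_sumr; apply: eq_bigr => q _; rewrite mulrACA.
Qed.

(** By the inequality of arithmetic and geometric means, an entry is at most the mean of two
    diagonal entries, each bounded by the trace. *)
Lemma psd_gram_normr_le (R : rcfType) (I : finType) (J : Type) (s : seq J)
    (u : J -> I -> R) (i j : I) :
  `|\sum_(q <- s) u q i * u q j| <= \sum_k \sum_(q <- s) u q k * u q k.
Proof.
have diag_le k :
    \sum_(q <- s) u q k * u q k <= \sum_k \sum_(q <- s) u q k * u q k.
  rewrite (bigD1 k) //= lerDl; apply: sumr_ge0 => l _.
  by apply: sumr_ge0 => q _; rewrite -expr2 sqr_ge0.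
have : `|\sum_(q <- s) u q i * u q j| <=
    2^-1 * \sum_(q <- s) u q i * u q i + 2^-1 * \sum_(q <- s) u q j * u q j.
  rewrite -mulrDr -big_split mulr_sumr /=.
  apply: le_trans (ler_norm_sum _ _ _) _; apply: ler_sum => q _.
  have := sqr_ge0 (u q i + u q j); have := sqr_ge0 (u q i - u q j).
  by rewrite ler_norml !expr2 => ? ?; apply/andP; split; nra.
by move: (diag_le i) (diag_le j); lra.
Qed.

(** * Closedness of the cone of sums of squares *)

Section GramPolynomials.

Variables (R : realType) (n : nat).
Implicit Types (q : {mpoly R[n]}) (s : seq {mpoly R[n]}).

(** Leading terms cannot cancel: if [M] is the largest leading monomial, the coefficient at [M + M]
    is the sum of the squares of the coefficients at [M]. *)
Lemma sos_mlead s : (forall q, q \in s -> q = 0) \/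
  exists2 M : 'X_{1..n}, (forall q, q \in s -> (mlead q <= M)%O) &
    0 < (\sum_(q <- s) q ^+ 2)@_(M + M).
Proof.
have coeff_sq M r : (forall q, q \in r -> (mlead q <= M)%O) ->
    (\sum_(q <- r) q ^+ 2)@_(M + M) = \sum_(q <- r) q@_M ^+ 2.
  move=> le_rM; rewrite raddf_sum /= !big_seq; apply: eq_bigr => q /le_rM leM.
  by rewrite expr2 (mleadcMW leM leM) expr2.
have [all0|[M le_sM [q qs [q_neq0 qM]]]] : (forall q, q \in s -> q = 0) \/
    exists2 M : 'X_{1..n}, (forall q, q \in s -> (mlead q <= M)%O) &
      exists2 q, q \in s & q != 0 /\ mlead q = M.
- elim: s => [|p s [all0|[M le_sM [q qs [q_neq0 qM]]]]]; first by left.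
    have [p0|p_neq0] := eqVneq p 0.
      by left=> q; rewrite inE => /predU1P[-> //|/all0].
    right; exists (mlead p); last by exists p; rewrite ?mem_head.
    move=> q; rewrite inE => /predU1P[-> //|/all0 ->].
    by rewrite mlead0; exact: le0x.
  right; have [le_pM|lt_Mp] := leP (mlead p) M.
    exists M; first by move=> r; rewrite inE => /predU1P[-> //|/le_sM].
    by exists q; rewrite ?inE ?qs ?orbT.
  exists (mlead p).
    move=> r; rewrite inE => /predU1P[-> //|/le_sM le_rM].
    exact: le_trans le_rM (ltW lt_Mp).
  exists p; rewrite ?mem_head //; split=> //.
  by apply: contraTneq lt_Mp => ->; rewrite mlead0 -leNgt le0x.
- by left.
- right; exists M => //; rewrite (coeff_sq M s le_sM) lt_def.
  rewrite sumr_ge0 ?andbT => [|r _]; last exact: sqr_ge0.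
  apply/eqP => sum0; move: q_neq0; rewrite -mleadc_eq0 qM -sqrf_eq0 => /eqP.
  apply; apply/eqP; move: sum0 => /eqP.
  rewrite psumr_eq0 => [|r _]; last exact: sqr_ge0.
  by move=> /allP /(_ q qs).
Qed.

Lemma sos_eq0 s : \sum_(q <- s) q ^+ 2 = 0 -> forall q, q \in s -> q = 0.
Proof.
by case: (sos_mlead s) => // -[M _]; move=> /[swap] ->; rewrite mcoeff0 ltxx.
Qed.

(** The monomial order is graded, so the degree of [q] is at most that of [M], and [M + M] occurs in
    the sum. Gram matrices of a fixed size therefore suffice. *)
Lemma sos_msize s q : q \in s -> (msize q <= msize (\sum_(q <- s) q ^+ 2))%N.
Proof.
move=> qs; case: (sos_mlead s) => [/(_ q qs) ->|[M /(_ q qs) leM coeff_gt0]].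
  by rewrite msize0.
have [->|q_neq0] := eqVneq q 0; first by rewrite msize0.
have /msize_mdeg_lt : (M + M)%MM \in msupp (\sum_(q <- s) q ^+ 2).
  by rewrite mcoeff_msupp gt_eqF.
rewrite -(mlead_deg q_neq0) mdegD.
by move/lemc_mdeg: leM => leM; apply: leq_ltn_trans; lia.
Qed.

Variable b : nat.
Let I : finType := 'X_{1..n < b}.

Definition lincomb (u : I -> R) : {mpoly R[n]} :=
  \sum_(i : I) u i *: 'X_[val i].

(** This is the product of [G] on both sides with the vector of all monomials of degree less than
    [b]. *)
Definition gram_poly (G : I -> I -> R) : {mpoly R[n]} :=
  \sum_(i : I) \sum_(j : I) G i j *: 'X_[val i + val j].

Lemma mcoeff_lincomb u (i : I) : (lincomb u)@_(val i) = u i.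
Proof.
rewrite raddf_sum /= (bigD1 i) //= mcoeffZ mcoeffX eqxx mulr1 big1 ?addr0 //.
move=> j /negPf neq_ji; rewrite mcoeffZ mcoeffX.
by rewrite -bmeqP neq_ji mulr0.
Qed.

Lemma lincombE q : (msize q <= b)%N -> q = lincomb (fun i => q@_(val i)).
Proof. exact: mpolywE. Qed.

Lemma gram_poly_rank1 (J : Type) (s : seq J) (u : J -> I -> R) :
  gram_poly (fun i j => \sum_(q <- s) u q i * u q j) =
  \sum_(q <- s) lincomb (u q) ^+ 2.
Proof.
under [RHS]eq_bigr => q _.
  rewrite expr2 mulr_suml.
  under eq_bigr => i _ do rewrite mulr_sumr.
  over.
rewrite exchange_big; apply: eq_bigr => i _.
rewrite exchange_big; apply: eq_bigr => j _.
rewrite scaler_suml; apply: eq_bigr => q _.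
by rewrite -scalerAl -scalerAr scalerA mpolyXD.
Qed.

Lemma mcoeff_gram_poly G (m : 'X_{1..n}) :
  (gram_poly G)@_m =
  \sum_(i : I) \sum_(j : I) G i j * (val i + val j == m)%MM%:R.
Proof.
rewrite raddf_sum; apply: eq_bigr => i _; rewrite raddf_sum.
by apply: eq_bigr => j _; rewrite /= mcoeffZ mcoeffX.
Qed.

End GramPolynomials.

Lemma sos_gram (R : realType) (n b : nat) (p : {mpoly R[n]}) :
  (msize p <= b)%N -> (exists s, p = \sum_(q <- s) q ^+ 2) ->
  exists G : 'X_{1..n < b} -> 'X_{1..n < b} -> R,
    [/\ psd G, p = gram_poly G & forall i j, `|G i j| <= \sum_k G k k].
Proof.
move=> le_pb [s pE]; rewrite {p}pE in le_pb *.
pose u (q : {mpoly R[n]}) (i : 'X_{1..n < b}) := q@_(val i).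
exists (fun i j => \sum_(q <- s) u q i * u q j); split.
- exact: psd_gram.
- rewrite gram_poly_rank1 !big_seq; apply: eq_bigr => q qs.
  by rewrite -lincombE // (leq_trans (sos_msize qs)).
- by move=> i j; exact: (psd_gram_normr_le s u i j).
Qed.

(* A limit of the Gram matrices themselves need not exist a priori, so they are
   first divided by [1 + trace]. If the normalizing factors tended to [0], the
   limit would be a positive semidefinite matrix of trace [1] representing the
   polynomial [0], contradicting [sos_eq0]. *)
Lemma sos_closed (R : realType) (n b : nat) (F : nat -> {mpoly R[n]})
    (f : {mpoly R[n]}) :
  (forall k, exists s, F k = \sum_(q <- s) q ^+ 2) ->
  (forall k, (msize (F k) <= b)%N) ->
  (forall m, (fun k => (F k)@_m) @ \oo --> f@_m) ->
  exists s, f = \sum_(q <- s) q ^+ 2.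
Proof.
move=> sosF le_Fb cvg_F.
have /choice [G GP] k := sos_gram (le_Fb k) (sosF k).
pose c k : R := (1 + \sum_i G k i i)^-1.
have psdG k : psd (G k) by case: (GP k).
have tr_ge0 k : 0 <= \sum_i G k i i.
  by apply: sumr_ge0 => i _; exact: psd_diag_ge0.
have c_gt0 k : 0 < c k by rewrite invr_gt0; move: (tr_ge0 k); lra.
have cE k : c k + \sum_i c k * G k i i = 1.
  rewrite -mulr_sumr -[X in X + _]mulr1 -mulrDr mulVf //.
  by rewrite gt_eqF //; move: (tr_ge0 k); lra.
(* The normalizing factor, at [None], and the matrix entries form one bounded family, so that a
   single subsequence serves them all. *)
pose a k (o : option ('X_{1..n < b} * 'X_{1..n < b})) : R :=
  if o is Some ij then c k * G k ij.1 ij.2 else c k.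
have le_a1 k o : `|a k o| <= 1.
  have := cE k; rewrite -mulr_sumr; move: (c_gt0 k) (tr_ge0 k) => cgt0 trge0.
  have : 0 <= c k * \sum_i G k i i by rewrite mulr_ge0 // ltW.
  case: o => [[i j]|] /= ? ?; last by rewrite gtr0_norm //; lra.
  rewrite normrM gtr0_norm //.
  have [_ _ /(_ i j) leG] := GP k.
  by have := ler_wpM2l (ltW cgt0) leG; lra.
have [phi phi_incr [l cvg_a]] := bounded_family_subseq le_a1.
pose H i j := l (Some (i, j)); pose z := l None.
have cvg_H i j : (fun k => c (phi k) * G (phi k) i j) @ \oo --> H i j.
  exact: cvg_a (Some (i, j)).
have cvg_c : (fun k => c (phi k)) @ \oo --> z by exact: cvg_a None.
have z_ge0 : 0 <= z.
  by apply: (cvgr_to_ge cvg_c); apply: nearW => k; rewrite ltW.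
have zE : z + \sum_i H i i = 1.
  have cvg_lhs : (fun k => c (phi k) + \sum_i c (phi k) * G (phi k) i i) @ \oo
      --> z + \sum_i H i i.
    by apply: cvgD => //; apply: cvg_sumr => i _.
  apply: (norm_cvg_unique cvg_lhs).
  by rewrite /=; under eq_fun do rewrite cE; exact: cvg_cst.
have psdH : psd H.
  split=> [i j|v].
    apply: (norm_cvg_unique (cvg_H i j)).
    have symG k : G k i j = G k j i by case: (psdG k).
    by rewrite /=; under eq_fun do rewrite symG; exact: cvg_H.
  have cvg_quad : (fun k => \sum_i \sum_j v i * v j *
      (c (phi k) * G (phi k) i j)) @ \oo --> quad_form H v.
    by apply: cvg_sumr => i _; apply: cvg_sumr => j _; apply: cvgM => //;
       exact: cvg_cst.
  apply: (cvgr_to_ge cvg_quad); apply: nearW => k.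
  have [_ /(_ v) quad_ge0] := psdG (phi k).
  under eq_bigr => i _ do under eq_bigr => j _ do rewrite mulrCA.
  under eq_bigr => i _ do rewrite -mulr_sumr.
  by rewrite -mulr_sumr mulr_ge0 // ltW.
(* Both sides are the coefficientwise limit of [c (phi k) *: F (phi k)]. *)
have gramH : gram_poly H = z *: f.
  apply/mpolyP => m; rewrite mcoeffZ.
  have cvg_lhs : (fun k => c (phi k) * (F (phi k))@_m) @ \oo
      --> (gram_poly H)@_m.
    rewrite mcoeff_gram_poly.
    have -> : (fun k => c (phi k) * (F (phi k))@_m) = (fun k => \sum_i \sum_j
        c (phi k) * G (phi k) i j * (val i + val j == m)%MM%:R).
      apply/funext => k; have [_ -> _] := GP (phi k).
      rewrite mcoeff_gram_poly mulr_sumr; apply: eq_bigr => i _.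
      by rewrite mulr_sumr; apply: eq_bigr => j _; rewrite mulrA.
    apply: cvg_sumr => i _; apply: cvg_sumr => j _; apply: cvgM => //.
    exact: cvg_cst.
  apply: (norm_cvg_unique cvg_lhs).
  by rewrite /=; apply: cvgM => //; exact: (cvg_subseq phi_incr (cvg_F m)).
have [s Hs] := psd_sum_rank1 psdH.
have sosH : \sum_(u <- s) lincomb u ^+ 2 = z *: f.
  rewrite -gramH -gram_poly_rank1.
  by congr gram_poly; apply/funext => i; apply/funext => j; rewrite Hs.
have [z0|z_neq0] := eqVneq z 0.
  have u0 u i : u \in s -> u i = 0.
    move=> us; rewrite -(mcoeff_lincomb u i).
    suff -> : lincomb u = 0 by rewrite mcoeff0.
    apply: (@sos_eq0 _ _ [seq lincomb u | u <- s]); last exact: map_f.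
    by rewrite big_map sosH z0 scale0r.
  move: zE; rewrite z0 add0r big1 => [/eqP|i _].
    by rewrite eq_sym oner_eq0.
  by rewrite Hs big_seq big1 // => u us; rewrite u0 // mul0r.
exists [seq (Num.sqrt z)^-1 *: lincomb u | u <- s].
rewrite big_map.
under eq_bigr do rewrite exprZn exprVn sqr_sqrtr //.
by rewrite -scaler_sumr sosH scalerA mulVf // scale1r.
Qed.

(** * Changing the number of variables *)

Lemma sum_modn (V : nmodType) (m k : nat) (g : nat -> V) :
  \sum_(0 <= j < k * m) g (j %% m)%N = (\sum_(0 <= r < m) g r) *+ k.
Proof.
elim: k => [|k IHk]; first by rewrite mul0n big_geq.
rewrite mulSnr (big_cat_nat (n := k * m)) ?leq_addr //= IHk mulrSr.
congr (_ + _); rewrite -{1}[(k * m)%N]add0n big_addn addKn.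
by apply: eq_big_nat => r /andP[_ lt_rm]; rewrite addnC modnMDl modn_small.
Qed.

Lemma comp_npsum (R : realType) (m n i : nat) (lq : n.-tuple {mpoly R[m]}) :
  npsum R n i \mPo lq = n%:R^-1 *: \sum_(j < n) tnth lq j ^+ i.
Proof.
rewrite /npsum comp_mpolyZ (raddf_sum (comp_mpoly lq)); congr (_ *: _).
apply: eq_bigr => j _; rewrite (tnth_nth 0).
by rewrite -comp_mpolyXU; exact: (rmorphXn (comp_mpoly lq)).
Qed.

(* Repeating each of the [m] variables [n %/ m] times and setting the remaining
   [n %% m] ones to [0] rescales all power means by the factor
   [t = (n %/ m) * m / n]. *)
Lemma npsum_repeat (R : realType) (m n : nat) : (0 < n)%N ->
  exists t : R, `|1 - t| <= m%:R / n%:R /\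
    exists lq : n.-tuple {mpoly R[m]}, forall i, (0 < i)%N ->
      npsum R n i \mPo lq = t *: npsum R m i.
Proof.
(* For [m = 0] the bound forces [t = 1], and both sides vanish because [i] is positive. *)
move=> n_gt0; case: m => [|m].
  exists 1; split; first by rewrite subrr normr0 mul0r.
  exists [tuple 0 | j < n] => i i_gt0.
  rewrite scale1r comp_npsum big1 ?scaler0 => [|j _].
    by rewrite /npsum big_ord0 scaler0.
  by rewrite tnth_mktuple expr0n -leqn0 leqNgt i_gt0.
pose k := (n %/ m.+1)%N.
have nE : n%:R = k%:R * m.+1%:R + (n %% m.+1)%:R :> R.
  by rewrite -natrM -natrD -divn_eq.
have nR_gt0 : 0 < n%:R :> R by rewrite ltr0n.
exists (k%:R * m.+1%:R / n%:R); split.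
  have -> : 1 - k%:R * m.+1%:R / n%:R = (n %% m.+1)%:R / n%:R :> R.
    rewrite -[X in X - _](divff (lt0r_neq0 nR_gt0)) -mulrBl {1}nE.
    by rewrite [X in X - _]addrC addrK.
  rewrite ger0_norm ?divr_ge0 ?ler0n // ler_pM2r ?invr_gt0 // ler_nat.
  by rewrite ltnW // ltn_pmod.
pose y j : {mpoly R[m.+1]} :=
  if (j < k * m.+1)%N then 'X_(inord (j %% m.+1)) else 0.
exists [tuple y j | j < n] => i i_gt0.
rewrite comp_npsum; under eq_bigr => j _ do rewrite tnth_mktuple.
rewrite -(big_mkord predT (fun j => y j ^+ i)).
rewrite (big_cat_nat (n := k * m.+1)) ?leq_trunc_div //=.
rewrite [X in _ + X]big1_seq ?addr0 => [|j]; last first.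
  rewrite mem_index_iota => /andP[_ /andP[le_kj _]].
  by rewrite /y ltnNge le_kj /= expr0n -leqn0 leqNgt i_gt0.
rewrite (eq_big_nat _ _ (F2 := fun j => 'X_(inord (j %% m.+1)) ^+ i)).
  rewrite (sum_modn _ _ (fun r => 'X_(inord r) ^+ i)) big_mkord.
  under eq_bigr => r _ do rewrite inord_val.
  rewrite -[_ *+ k]scaler_nat !scalerA; congr (_ *: _).
  by field; rewrite nat1r !pnatr_eq0 -!lt0n n_gt0.
by move=> j /andP[_ lt_jk]; rewrite /y lt_jk.
Qed.

Section Rescaling.

Variables (R : realType) (k : nat).
Implicit Types (c : part k -> R) (l : part k).

Definition num_parts l : nat := (\sum_i val l i)%N.

Definition rescale (t : R) c l : R := t ^+ num_parts l * c l.

Lemma symform_repeat (m n : nat) (t : R) (lq : n.-tuple {mpoly R[m]}) c :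
  (forall i, (0 < i)%N -> npsum R n i \mPo lq = t *: npsum R m i) ->
  symform n c \mPo lq = symform m (rescale t c).
Proof.
move=> npsum_lq; rewrite /symform (raddf_sum (comp_mpoly lq)).
apply: eq_bigr => l _; apply: (etrans (comp_mpolyZ _ _ _)).
rewrite /rescale mulrC -scalerA; congr (_ *: _).
rewrite /plam (rmorph_prod (comp_mpoly lq)) /num_parts expr_sum -scaler_prod.
apply: eq_bigr => i _; rewrite -exprZn.
rewrite (rmorphXn (comp_mpoly lq)).
(* The power mean of exponent [0] does not scale by [t], but [is_partm] gives it multiplicity
   [0]. *)
case: (unliftP ord0 i) => [j ->|->]; first by rewrite /= npsum_lq.
by have /andP[/eqP -> _] := valP l.
Qed.

(** The functional [phi] is left general to cover both evaluation at a point and extraction of a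
    coefficient. *)
Lemma symform_rescale_cvg (m : nat) (t : nat -> R) c
    (phi : {scalar {mpoly R[m]}}) :
  t @ \oo --> (1 : R) ->
  (fun j => phi (symform m (rescale (t j) c))) @ \oo --> phi (symform m c).
Proof.
move=> cvg_t.
have phiE c' : phi (symform m c') = \sum_l c' l * phi (plam R m l).
  by rewrite raddf_sum; apply: eq_bigr => l _; exact: linearZ.
rewrite phiE; under eq_fun do rewrite phiE.
apply: cvg_sumr => l _; apply: cvgM; last exact: cvg_cst.
rewrite -[X in _ --> X]mul1r -(expr1n _ (num_parts l)).
apply: cvgM; last exact: cvg_cst.
elim: (num_parts l) => [|e IHe]; first exact: cvg_cst.
by rewrite exprS; under eq_fun do rewrite exprS; exact: cvgM.
Qed.

Lemma msize_symform (m : nat) :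
  exists b, forall c, (msize (symform m c) <= b)%N.
Proof.
exists (\max_(l : part k) msize (plam R m l))%N => c.
apply: leq_trans (msize_sum _ _ _) _; apply/bigmax_leqP => l _.
by apply: leq_trans (mmeasureZ_le _ _ _) _; exact: leq_bigmax.
Qed.

(** For each [j], some [n] at least [j + 1] satisfies [A], and its factor differs from [1] by at
    most [m / (j + 1)]. The predicate [A] will be nonnegativity or being a sum of squares in [n]
    variables. *)
Lemma symform_repeat_seq (A : nat -> Prop) (m : nat) c :
  (forall N, exists n, (N <= n)%N /\ A n) ->
  exists2 t : nat -> R, t @ \oo --> (1 : R) & forall j, exists2 n, A n &
    exists lq : n.-tuple {mpoly R[m]},
      symform n c \mPo lq = symform m (rescale (t j) c).
Proof.
move=> infA.
have /choice [t tP] j : exists t : R, `|1 - t| <= m%:R * j.+1%:R^-1 /\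
    exists2 n, A n & exists lq : n.-tuple {mpoly R[m]},
      symform n c \mPo lq = symform m (rescale t c).
  have [n [lt_jn An]] := infA j.+1.
  have [t [t_near1 [lq npsum_lq]]] :=
    npsum_repeat R m (leq_ltn_trans (leq0n j) lt_jn).
  exists t; split.
    apply: le_trans t_near1 _; apply: ler_wpM2l => //.
    by rewrite lef_pV2 ?posrE ?ltr0n ?ler_nat // (leq_trans _ lt_jn).
  by exists n => //; exists lq; exact: symform_repeat.
exists t => [|j]; last by case: (tP j).
apply/cvgrPdist_le => eps eps_gt0.
have : (fun j => m%:R * j.+1%:R^-1 : R) @ \oo --> (0 : R).
  rewrite -[X in _ --> X](mulr0 m%:R).
  by apply: cvgM; [exact: cvg_cst|exact: cvg_harmonic].
move=> /cvgrPdist_le /(_ _ eps_gt0); apply: filterS => j.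
rewrite sub0r normrN ger0_norm ?divr_ge0 //; apply: le_trans.
by case: (tP j).
Qed.

End Rescaling.

(** * Passage to the limit for both cones *)

Section Limit.

Variables (R : realType) (d : nat).
Implicit Types (c : part (2 * d) -> R).

Lemma PS_infinitely_often c (m : nat) :
  (forall N, exists n, (N <= n)%N /\ PS n c) -> PS m c.
Proof.
move=> infPS x; have [t cvg_t PSt] := symform_repeat_seq m c infPS.
have cvg_x := @symform_rescale_cvg R _ m t c (meval x) cvg_t.
apply: (cvgr_to_ge cvg_x); apply: nearW => j.
have [n PSn [lq <-]] := PSt j.
by rewrite [X in _ <= X]comp_mpoly_meval; exact: PSn.
Qed.

Lemma SigmaS_infinitely_often c (m : nat) :
  (forall N, exists n, (N <= n)%N /\ SigmaS n c) -> SigmaS m c.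
Proof.
move=> infS; have [t cvg_t St] := symform_repeat_seq m c infS.
have [b le_b] := msize_symform R (2 * d) m.
apply: (@sos_closed R m b (fun j => symform m (rescale (t j) c))) => // [j|g].
  have [n [s symE] [lq <-]] := St j.
  exists [seq q \mPo lq | q <- s].
  rewrite symE (raddf_sum (comp_mpoly lq)) big_map.
  by apply: eq_bigr => q _; exact: (rmorphXn (comp_mpoly lq)).
exact: (@symform_rescale_cvg R _ m t c (mcoeff g) cvg_t).
Qed.

End Limit.

(** The lower limit contains the intersection and lies in the upper limit; the hypothesis puts the
    upper limit back inside the intersection. *)
Lemma set_limit_infinitely_often (T : Type) (A : nat -> T -> Prop) (n0 : nat) :
  (forall x m, (forall N, exists n, (N <= n)%N /\ A n x) -> A m x) ->
  set_limit A (fun x => forall n, (n0 <= n)%N -> A n x).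
Proof.
move=> infA; split=> x; split=> [Ax|].
- by exists n0.
- move=> [N AN] n _; apply: infA => M; exists (maxn M N).
  by rewrite leq_maxl; split=> //; apply: AN; exact: leq_maxr.
- move=> N; exists (maxn N n0); rewrite leq_maxl; split=> //.
  by apply: Ax; exact: leq_maxr.
- by move=> Ainf n _; exact: infA.
Qed.

Theorem theorem1p1 (R : realType) (d : nat) :
  set_limit (fun n => @PS R n d) (@frakP R d) /\
  set_limit (fun n => @SigmaS R n d) (@frakS R d).
Proof.
split; apply: set_limit_infinitely_often => c m.
- exact: PS_infinitely_often.
- exact: SigmaS_infinitely_often.
Qed.
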